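(* Let $a,b$ be positive integers with $2\le a<b$, and write $b=ka+r$ with $k$ odd and $0<r<a$. Then the subtraction set of the subtraction game $\mathcal{S}(a,b,a+b)$ has expansion \[\big(\{sa: s\text{ odd},\ s\le k\}\cup\{ka+1,ka+2,\ldots,b+a\}\cup\{b+sa: s\text{ odd},\ s\le k\}\big)^{*(b+(k+1)a)}.\]
   Context: For a finite set $S$ of positive integers, the subtraction game $\mathcal{S}(S)$ is played on a single pile: two players alternately remove $s\in S$ coins (at most the pile size); the last mover wins. The nim-value is $\mathcal{G}(n)=\operatorname{mex}\{\mathcal{G}(n-s): s\in S, s\le n\}$. The expansion of $S$ is $S^{ex}=\{s\ge1:\mathcal{G}(n+s)\ne\mathcal{G}(n)\ \forall n\ge0\}$; ''has expansion $T$'' means $S^{ex}=T$. For a set $X$ and $p\ge1$, $X^{*p}=\{x+mp:x\in X,m\ge0\}$. *)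

(* Defs.v *)
From mathcomp Require Import all_boot finmap.
From mathcomp Require Import boolp classical_sets.

Set Implicit Arguments.
Unset Strict Implicit.
Unset Printing Implicit Defensive.

Local Open Scope classical_set_scope.

Lemma mex_subproof (A : {fset nat}) : exists n, n \notin A.
Proof.
exists (\max_(x <- A) x).+1; apply/negP => xA.
by have := @leq_bigmax_seq _ (enum_fset A) xpredT id _ xA isT; rewrite ltnn.
Qed.

Definition mex (A : {fset nat}) : nat := ex_minn (mex_subproof A).

(* The sequence of the nim-values of the piles of sizes 0, ..., n - 1 in the
   subtraction game with subtraction set S. *)
Fixpoint nim_values (S : {fset nat}) (n : nat) : seq nat :=
  if n is m.+1 then
    let v := nim_values S m in
    rcons v (mex [fset nth 0 v (m - s) | s in S & s <= m]%fset)
  else [::].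

Definition nim_value (S : {fset nat}) (n : nat) : nat :=
  nth 0 (nim_values S n.+1) n.

Lemma size_nim_values (S : {fset nat}) (n : nat) : size (nim_values S n) = n.
Proof. by elim: n => //= n IHn; rewrite size_rcons IHn. Qed.

Lemma nth_nim_values (S : {fset nat}) (m n : nat) :
  m < n -> nth 0 (nim_values S n) m = nim_value S m.
Proof.
elim: n => // n IHn; rewrite ltnS leq_eqVlt => /predU1P[->//|lt_mn].
by rewrite /= nth_rcons size_nim_values lt_mn IHn.
Qed.

Lemma nim_valueE (S : {fset nat}) (n : nat) : 0 \notin S ->
  nim_value S n = mex [fset nim_value S (n - s) | s in S & s <= n]%fset.
Proof.
move=> S0; rewrite {1}/nim_value /= nth_rcons size_nim_values ltnn eqxx.
congr mex; apply: eq_in_imfset => //= s; case/andP=> sS le_sn.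
rewrite nth_nim_values // ltn_subrL (leq_trans _ le_sn) ?andbT.
  by rewrite lt0n; apply: contraNneq S0 => <-.
by rewrite lt0n; apply: contraNneq S0 => <-.
Qed.

Definition expansion (S : {fset nat}) : set nat :=
  [set s | 1 <= s /\ forall n, nim_value S (n + s) <> nim_value S n].

(* X^{*p} *)
Definition periodic_extension (X : set nat) (p : nat) : set nat :=
  [set x + m * p | x in X & m in [set: nat]].

(* Main.v *)
Require Import Defs.
From mathcomp Require Import all_boot finmap.
From mathcomp Require Import boolp classical_sets.
From mathcomp Require Import zify.

Local Open Scope classical_set_scope.

(** Put p = b + (k + 1)a. For x < p, the nim-value of every pile congruent to x
    modulo p is twice the indicator of (k + 1)a <= x, plus the parity of x %/ a.
    A difference s separates all pairs of such values iff s mod p lies in the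
    displayed set X. As a, b and a + b lie in X, half of the mex recursion for
    this formula is a special case of that. Both X and the separation property
    are invariant under s |-> p - s. *)

Lemma mex_eq (A : {fset nat}) (v : nat) :
  v \notin A -> (forall w, w < v -> w \in A) -> mex A = v.
Proof.
move=> vA ltA; rewrite /mex; case: ex_minnP => m mA min_m.
apply/eqP; rewrite eqn_leq min_m //= leqNgt.
by apply/negP => /ltA; apply/negP.
Qed.

(** Strong induction with the mex recursion. The first hypothesis looks upward from [n], so it is
    literally the expansion condition for the elements of [S]. *)
Lemma nim_value_unique (S : {fset nat}) (f : nat -> nat) : 0 \notin S ->
  (forall n s, s \in S -> f (n + s) <> f n) ->
  (forall n w, w < f n -> exists s, [/\ s \in S, s <= n & f (n - s) = w]) ->
  nim_value S =1 f.
Proof.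
move=> S0 f_neq f_reach; elim/ltn_ind => n IHn.
have IHs s : s \in S -> s <= n -> nim_value S (n - s) = f (n - s).
  move=> sS le_sn; apply: IHn.
  have: s != 0 by apply: contraNneq S0 => <-.
  by lia.
rewrite nim_valueE //; apply: mex_eq => [|w /f_reach [s [sS le_sn <-]]].
  apply/imfsetP => -[s /= /andP[sS le_sn]]; rewrite IHs // => fn.
  by apply: (f_neq (n - s) s sS); rewrite subnK.
by apply/imfsetP; exists s; rewrite /= ?IHs // inE sS.
Qed.

Lemma divn_eq_of_bounds (a q x : nat) : q * a <= x -> x < q * a + a -> x %/ a = q.
Proof.
move=> qx xq; have a_gt0 : 0 < a by lia.
by rewrite -(subnKC qx) divnMDl // divn_small ?addn0 //; lia.
Qed.

(** For [k] odd, the blocks of length [a] in a period read 0, 1, ..., 0, 1 and then 2, 3, ..., 2, 3,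
    where only the last block is incomplete, of length [r]. *)
Definition block_value (a k x : nat) : nat :=
  (((k + 1) * a <= x)%N).*2 + odd (x %/ a).

Definition separating (a b k : nat) : set nat :=
  [set s * a | s in [set s | odd s /\ s <= k]]
  `|` [set n | k * a + 1 <= n <= b + a]
  `|` [set b + s * a | s in [set s | odd s /\ s <= k]].

Lemma block_value_lt (a k x : nat) :
  x < (k + 1) * a -> block_value a k x = odd (x %/ a).
Proof. by rewrite /block_value ltnNge => /negbTE->. Qed.

Lemma block_value_ge (a k x : nat) :
  (k + 1) * a <= x -> block_value a k x = 2 + odd (x %/ a).
Proof. by rewrite /block_value => ->. Qed.

Lemma separating_bounds (a k r t : nat) : 0 < r < a -> odd k ->
  separating a (k * a + r) k t -> 0 < t < k * a + r + (k + 1) * a.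
Proof.
move=> r_bd k_odd [[[s [s_odd le_sk] <-]|/=]|[s [s_odd le_sk] <-]].
- have := leq_mul2r a s k; rewrite le_sk orbT.
  by case: s s_odd le_sk => // s _ _; rewrite !mulSn mulnDl; lia.
- by rewrite mulnDl; case: k k_odd => // k _; rewrite !mulSn; lia.
- have := leq_mul2r a s k; rewrite le_sk orbT.
  by rewrite mulnDl; lia.
Qed.

Lemma separating_sub (a k r t : nat) : 0 < r < a -> odd k ->
  separating a (k * a + r) k t ->
  separating a (k * a + r) k (k * a + r + (k + 1) * a - t).
Proof.
move=> r_bd k_odd [[[s [s_odd le_sk] <-]|/=]|[s [s_odd le_sk] <-]].
- right; exists (k + 1 - s).
    by split; [rewrite oddB ?oddD ?k_odd ?s_odd //; lia | case: s s_odd le_sk; lia].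
  by rewrite mulnBl mulnDl; have := leq_mul2r a s k; rewrite le_sk orbT; lia.
(* The reflected interval is ka, ..., b + a - 1; its lower end falls outside the original interval
   but is the case s = k of the first family. *)
- move=> t_bd; have [->|t_neq] := eqVneq t (k * a + r + a).
    by left; left; exists k => //; rewrite mulnDl; lia.
  by left; right => /=; rewrite mulnDl; lia.
- left; left; exists (k + 1 - s).
    by split; [rewrite oddB ?oddD ?k_odd ?s_odd //; lia | case: s s_odd le_sk; lia].
  by rewrite mulnBl mulnDl; have := leq_mul2r a s k; rewrite le_sk orbT; lia.
Qed.

(** Only [x] and [x + t] on the same side of (k + 1)a need care. There an odd multiple of [a] flips
    the block parity, a [t] in the interval can only join the first block of that side to its last
    one, and the third family is too long to fit. *)
Lemma block_value_neq (a k r t x : nat) : 0 < r < a -> odd k ->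
  separating a (k * a + r) k t -> x + t < k * a + r + (k + 1) * a ->
  block_value a k (x + t) <> block_value a k x.
Proof.
move=> r_bd k_odd Xt lt_p.
have a_gt0 : 0 < a by lia.
case: (leqP ((k + 1) * a) x) => hx; last first.
  case: (leqP ((k + 1) * a) (x + t)) => hy.
    by rewrite block_value_ge // block_value_lt //; case: (odd _); case: (odd _).
  rewrite !block_value_lt //.
  case: Xt lt_p hy => [[[s [s_odd le_sk] <-]|/=]|[s [s_odd le_sk] <-]].
  - by rewrite addnC divnMDl // oddD s_odd; case: (odd _).
  - move=> t_bd _ hy; rewrite mulnDl in hy.
    rewrite (divn_eq_of_bounds a k (x + t)) ?(divn_small (m := x)) ?k_odd //; lia.
  - case: s s_odd {le_sk} => // s _ _.
    by rewrite mulSn mulnDl; lia.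
have hy : (k + 1) * a <= x + t by lia.
rewrite !block_value_ge //.
case: Xt lt_p hy => [[[s [s_odd le_sk] <-]|/=]|[s [s_odd le_sk] <-]].
- by rewrite [x + _]addnC divnMDl // oddD s_odd; case: (odd _).
- move=> t_bd lt_p _; rewrite mulnDl in lt_p hx.
  rewrite (divn_eq_of_bounds a (k + k + 1) (x + t)) ?mulnDl; try lia.
  rewrite (divn_eq_of_bounds a (k + 1) x) ?mulnDl; try lia.
- by lia.
Qed.

Lemma block_value_eq (a k r t : nat) : 0 < r < a -> odd k -> t < k * a ->
  ~ separating a (k * a + r) k t ->
  exists2 x, x + t < k * a + r + (k + 1) * a &
    block_value a k (x + t) = block_value a k x.
Proof.
move=> r_bd k_odd lt_t Xt.
have a_gt0 : 0 < a by lia.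
have lt_tk : t %/ a < k by rewrite ltn_divLR.
have t_eq := divn_eq t a; have t_mod := ltn_pmod t a_gt0.
case: (boolP (odd (t %/ a))) => t_odd; last first.
  exists 0; first by lia.
  rewrite add0n !block_value_lt ?mulnDl; try lia.
  by rewrite (negbTE t_odd) div0n.
have t_mod0 : t %% a != 0.
  apply/eqP => t_mod0; apply: Xt; left; left; exists (t %/ a); last by lia.
  by split=> //; apply: ltnW.
(* This [x] lies in block 0 and moves [t] up to the start of the next block, whose index is even:
   both values are 0. *)
exists (a - t %% a); first by rewrite mulnDl; lia.
rewrite !block_value_lt ?mulnDl; try lia.
rewrite (divn_eq_of_bounds a (t %/ a).+1) ?mulSn; try lia.
by rewrite /= t_odd divn_small //; lia.
Qed.

Definition periodic_value (a k r n : nat) : nat :=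
  block_value a k (n %% (k * a + r + (k + 1) * a)).

(** The two preceding lemmas compare piles inside one period; the reflection t |-> p - t handles
    sums that wrap around and, in the converse, residues beyond b + a. *)
Lemma separating_sum (a k r s : nat) (f := periodic_value a k r)
    (p := k * a + r + (k + 1) * a) : 0 < r < a -> odd k ->
  separating a (k * a + r) k (s %% p) <-> (forall n, f (n + s) <> f n).
Proof.
move=> r_bd k_odd; have p_gt0 : 0 < p by rewrite /p; lia.
rewrite /f /periodic_value -/p.
have modD n : (n + s) %% p = (n %% p + s %% p) %% p by rewrite modnDm.
have := ltn_pmod s p_gt0; move: (s %% p) modD => t modD lt_t.
split=> [Xt n|f_neq].
  rewrite modD; have := ltn_pmod n p_gt0; move: (n %% p) => x lt_x.
  case: (ltnP (x + t) p) => [lt_p|ge_p].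
    by rewrite modn_small //; apply: (@block_value_neq a k r).
  have -> : (x + t) %% p = x + t - p.
    by rewrite -{1}(subnK ge_p) modnDr modn_small //; lia.
  have {2}-> : x = (x + t - p) + (p - t) by lia.
  apply: nesym; apply: (@block_value_neq a k r) => //; last by rewrite -/p; lia.
  exact: separating_sub.
apply: contrapT => Xt.
case: (ltnP t (k * a)) => [lt_tk|ge_t].
  have [x lt_x x_eq] := block_value_eq a k r t r_bd k_odd lt_tk Xt.
  by apply: (f_neq x); rewrite modD (modn_small (m := x)) ?modn_small //; rewrite /p; lia.
have t_neq : t <> k * a by move=> tE; apply: Xt; left; left; exists k.
have gt_t : k * a + r + a < t.
  by rewrite ltnNge; apply/negP => le_t; apply: Xt; left; right => /=; lia.
have lt_pt : p - t < k * a by rewrite /p mulnDl; lia.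
have [|x lt_x x_eq] := block_value_eq a k r (p - t) r_bd k_odd lt_pt.
  by move/(separating_sub a k r _ r_bd k_odd); rewrite -/p subKn // ltnW.
(* Adding [t] to this pile returns to [x] modulo [p], so the equality for p - t becomes one for
   [t]. *)
apply: (f_neq (x + (p - t))); rewrite modD.
rewrite (modn_small (m := x + (p - t))) // x_eq.
have -> : x + (p - t) + t = x + p by lia.
by rewrite modnDr modn_small //; rewrite /p; lia.
Qed.

(** On the lower side, removing [a] leads from 1 to 0. On the upper side, removing [b] lands on the
    lower side, a further [a] gives the other low value, and [a] alone leads from 3 to 2. *)
Lemma block_value_reach (a k r x w : nat) : 0 < r < a -> odd k ->
  x < k * a + r + (k + 1) * a -> w < block_value a k x ->
  exists s, [/\ s \in [:: a; k * a + r; a + (k * a + r)], s <= x &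
    block_value a k (x - s) = w].
Proof.
move=> r_bd k_odd lt_x; have a_gt0 : 0 < a by lia.
have step y : a <= y -> odd ((y - a) %/ a) = ~~ odd (y %/ a).
  by move=> le_ay; rewrite -{2}(subnK le_ay) divnDr // divnn a_gt0 oddD addbT negbK.
have [hx|hx] := ltnP x ((k + 1) * a).
  rewrite block_value_lt // => lt_w.
  have x_odd : odd (x %/ a) by move: lt_w; case: (odd _).
  have le_ax : a <= x by rewrite leqNgt; apply/negP => /divn_small x0; rewrite x0 in x_odd.
  exists a; rewrite inE eqxx le_ax; split=> //.
  by rewrite block_value_lt ?step ?x_odd; move: lt_w; rewrite ?x_odd; lia.
rewrite block_value_ge // => lt_w.
set b := k * a + r in lt_x *; have bE : b = k * a + r by [].
have lt_xb : x - b < (k + 1) * a by lia.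
have le_bx : b <= x by move: hx; rewrite mulnDl; lia.
case: (leqP a (x - b)) => hxb.
  have [w_eq|w_neq] := eqVneq w (odd ((x - b) %/ a)).
    by exists b; rewrite !inE eqxx orbT block_value_lt.
  have [w_lt2|w_ge2] := ltnP w 2.
    exists (a + b); rewrite !inE eqxx !orbT; split=> //; first by lia.
    rewrite addnC subnDA block_value_lt ?step //; last by lia.
    by move: w_neq w_lt2; case: (odd _); lia.
  have x_odd : odd (x %/ a) by move: lt_w; case: (odd _) => //; lia.
  (* The value is 3 here, whereas block k + 1 has value 2; so removing [a] stays on the upper
     side. *)
  have hx2 : (k + 1) * a + a <= x.
    rewrite leqNgt; apply/negP => hx2.
    by move: x_odd; rewrite (divn_eq_of_bounds a (k + 1)) // oddD k_odd.
  exists a; rewrite inE eqxx; split=> //; first by lia.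
  rewrite block_value_ge; last by lia.
  rewrite step; last by lia.
  by rewrite x_odd in lt_w *; lia.
(* Now a + b may exceed [x], but [x] is in block k + 1, of value 2: removing [b] leads to block 0
   and removing [a] to block k, of value 1. *)
rewrite mulnDl mul1n in hx.
have xk : x %/ a = k + 1 by apply: divn_eq_of_bounds; rewrite mulnDl; lia.
move: lt_w; rewrite xk oddD k_odd addn0; case: w => [|[|//]] _.
  exists b; rewrite !inE eqxx orbT; split=> //.
  by rewrite block_value_lt ?mulnDl ?divn_small //; lia.
exists a; rewrite inE eqxx; split=> //; first by lia.
rewrite block_value_lt; last by rewrite mulnDl; lia.
rewrite step; last by lia.
by rewrite xk oddD k_odd.
Qed.

Lemma nim_value_periodic (a k r : nat) : 0 < r < a -> odd k ->
  nim_value [fset a; (k * a + r)%N; (a + (k * a + r))%N]%fset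
    =1 periodic_value a k r.
Proof.
move=> r_bd k_odd; set p := k * a + r + (k + 1) * a.
have k_gt0 : 0 < k by case: k k_odd {p}.
have le_aka : a <= k * a by rewrite leq_pmull.
have p_gt : a + (k * a + r) < p by rewrite /p mulnDl; lia.
apply: nim_value_unique => [|n s|n w].
- by rewrite !inE; lia.
- rewrite !inE => s_in.
  have lt_s : s < p by lia.
  apply: (separating_sum a k r s r_bd k_odd).1 n.
  rewrite -/p modn_small //.
  case/orP: s_in => [/orP[]|] /eqP->.
  + by left; left; exists 1; rewrite /= ?mul1n.
  + by left; right => /=; lia.
  + by left; right => /=; lia.
- have p_gt0 : 0 < p by lia.
  case/(block_value_reach a k r _ w r_bd k_odd (ltn_pmod n p_gt0)) => s [s_in le_s <-]; exists s; split.
  + by move: s_in; rewrite !inE orbA.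
  + exact: leq_trans le_s (leq_mod _ _).
  (* As [s] is at most n %% p, the move does not cross a multiple of [p]. *)
  + rewrite /periodic_value -/p {1}(divn_eq n p) -addnBA // modnMDl modn_small //.
    by have := ltn_pmod n p_gt0; rewrite -/p in le_s *; lia.
Qed.

Theorem theorem4p1 (a b k r : nat) :
  2 <= a -> a < b ->
  b = k * a + r -> odd k -> 0 < r < a ->
  expansion [fset a; b; (a + b)%N]%fset =
  periodic_extension
    ([set s * a | s in [set s | odd s /\ s <= k]]
     `|` [set n | k * a + 1 <= n <= b + a]
     `|` [set b + s * a | s in [set s | odd s /\ s <= k]])
    (b + (k + 1) * a).
Proof.
move=> _ _ -> k_odd r_bd; rewrite -/(separating a (k * a + r) k).
set p := k * a + r + (k + 1) * a.
have valE := nim_value_periodic a k r r_bd k_odd.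
apply/seteqP; split=> [s [s_gt0 s_neq]|s [x Xx [m _ <-]]].
  exists (s %% p); last by exists (s %/ p); rewrite // addnC -divn_eq.
  by apply/separating_sum => // n; rewrite -!valE.
(* These bounds make x + mp positive and [x] its residue modulo [p]. *)
have /andP[x_gt0 lt_x] := separating_bounds a k r x r_bd k_odd Xx.
split=> [|n]; first by lia.
rewrite !valE; apply: (separating_sum a k r _ r_bd k_odd).1 n.
by rewrite [x + _]addnC modnMDl modn_small.
Qed.
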